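(* Assume the Continuum Hypothesis. Let $S$ be a semifilter, and let $X\subseteq[\mathbb{N}]^{\infty}$ be a cofinal $\mathrm{cF}$-scale. Then the set $X\cup[\mathbb{N}]^{<\infty}$, with the subspace topology inherited from the Cantor space $P(\mathbb{N})$, is productively $S$-Menger but not productively Lindelöf.
   Context: $[\mathbb{N}]^{\infty}$ is the family of infinite subsets of $\mathbb{N}$, $[\mathbb{N}]^{<\infty}$ the family of finite subsets of $\mathbb{N}$, and $P(\mathbb{N})=[\mathbb{N}]^\infty\cup[\mathbb{N}]^{<\infty}$ is identified with the Cantor space $\{0,1\}^{\mathbb{N}}$. Each $a\in[\mathbb{N}]^\infty$ is identified with its increasing enumeration, so $a(n)$ is the $n$-th smallest element of $a$. A semifilter is a set $S\subseteq[\mathbb{N}]^\infty$ such that for each $s\in S$ and each $b\in[\mathbb{N}]^\infty$ with $s\setminus b$ finite, $b\in S$. $\mathrm{cF}$ is the (semi)filter of cofinite subsets of $\mathbb{N}$. For $a,b\in[\mathbb{N}]^\infty$, $a\le_S b$ means $\{n: a(n)\le b(n)\}\in S$; $\mathfrak{b}(S)$ is the minimal cardinality of a $\le_S$-unbounded subset of $[\mathbb{N}]^\infty$. A cofinal $S$-scale is a set $X\subseteq[\mathbb{N}]^\infty$ with $|X|\ge\mathfrak{b}(S)$ such that for each $b\in[\mathbb{N}]^\infty$, $b\le_S x$ for all but less than $\mathfrak{b}(S)$ elements $x\in X$ (for $S=\mathrm{cF}$, $\le_S$ is eventual dominance $\le^*$ and $\mathfrak{b}(\mathrm{cF})=\mathfrak{b}$).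 A topological space $X$ is $S$-Menger if for each sequence $\mathcal{U}_1,\mathcal{U}_2,\dots$ of open covers of $X$ there are finite sets $\mathcal{F}_n\subseteq\mathcal{U}_n$ such that $\{n\in\mathbb{N}: x\in\bigcup\mathcal{F}_n\}\in S$ for all $x\in X$. For a property $\mathbf{P}$ of topological spaces, a space $X$ is productively $\mathbf{P}$ if $X\times Y$ has property $\mathbf{P}$ for every topological space $Y$ with property $\mathbf{P}$. *)

(* Defs.v *)
From HB Require Import structures.
From mathcomp Require Import all_boot all_order all_algebra.
From mathcomp Require Import all_classical all_reals all_analysis.

Set Implicit Arguments.
Unset Strict Implicit.
Unset Printing Implicit Defensive.

Local Open Scope classical_set_scope.
Local Open Scope card_scope.

(* N is nat, starting at 0: enumerations and sequences of covers are indexed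
   from 0. Replacing {1, 2, ...} by {0, 1, ...} is a mere relabelling. *)

Definition Ninf : set (set nat) := [set a | infinite_set a].
Definition Nfin : set (set nat) := [set a | finite_set a].

(* The value is junk when a is finite; see incr_enumP for infinite a. *)
Definition incr_enum (a : set nat) : nat -> nat :=
  xget (fun n : nat => n)
    [set e : nat -> nat | {homo e : m n / (m < n)%N} /\ range e = a].

Lemma incr_enumP (a : set nat) : Ninf a ->
  {homo incr_enum a : m n / (m < n)%N} /\ range (incr_enum a) = a.
Proof.
move=> ainf; suff [e he] :
    exists e : nat -> nat, {homo e : m n / (m < n)%N} /\ range e = a.
  exact: (@xgetPex _ (fun n : nat => n)
    [set e : nat -> nat | {homo e : m n / (m < n)%N} /\ range e = a] (ex_intro _ e he)).
have ex m : exists k, `[< a k >] && (m <= k)%N.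
  apply: contrapT => nex; apply: ainf.
  apply: (@sub_finite_set _ _ `I_m); last exact: finite_II.
  move=> k ak /=; rewrite ltnNge; apply/negP => mk.
  by apply: nex; exists k; rewrite mk andbT; exact/asboolP.
pose next m := ex_minn (ex m).
have nextP m : [/\ a (next m), (m <= next m)%N &
    forall k, a k -> (m <= k)%N -> (next m <= k)%N].
  rewrite /next; case: ex_minnP => k /andP[/asboolP ak mk] kmin; split => //.
  by move=> j aj mj; apply: kmin; rewrite mj andbT; exact/asboolP.
pose e := fix e n := if n is n'.+1 then next (e n').+1 else next 0%N.
have eS n : (e n < e n.+1)%N by have [] := nextP (e n).+1.
have ehomo : {homo e : m n / (m < n)%N} by apply: homo_ltn => //; exact: ltn_trans.
have ege n : (n <= e n)%N.
  by elim: n => // n ih; exact: leq_ltn_trans ih (eS n).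
exists e; split => //; apply/seteqP; split => [_ [[|n] _ <-]|k ak].
- by have [] := nextP 0%N.
- by have [] := nextP (e n).+1.
have exn : exists n, (k <= e n)%N by exists k.
case: (ex_minnP exn) => n kn nmin.
exists n => //; apply/eqP; rewrite eqn_leq kn andbT.
case: n kn nmin => [|n] kn nmin; first by have [_ _] := nextP 0%N; apply.
have [_ _] := nextP (e n).+1; apply => //.
by rewrite ltnNge; apply/negP => /nmin; rewrite ltnn.
Qed.

Definition semifilter (S : set (set nat)) : Prop :=
  S `<=` Ninf /\
  forall s b, S s -> Ninf b -> finite_set (s `\` b) -> S b.

Definition cF : set (set nat) := [set a | cofinite_set a].

Definition leS (S : set (set nat)) (a b : set nat) : Prop :=
  S [set n | (incr_enum a n <= incr_enum b n)%N].

Definition leS_unbounded (S A : set (set nat)) : Prop :=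
  A `<=` Ninf /\ ~ exists2 b, Ninf b & forall a, A a -> leS S a b.

(* The cardinal b(S) is represented by any unbounded set of minimal
   cardinality: is_bnum S B means |B| = b(S). *)
Definition is_bnum (S B : set (set nat)) : Prop :=
  leS_unbounded S B /\ forall A, leS_unbounded S A -> B #<= A.

Definition cofinal_scale (S X : set (set nat)) : Prop :=
  X `<=` Ninf /\
  exists B, [/\ is_bnum S B, B #<= X &
    forall b, Ninf b -> ~~ (B #<= [set x | X x /\ ~ leS S b x])].

Definition CH : Prop :=
  forall A : set (set nat), countable A \/ A #= [set: set nat].

(* A family of subsets of N as a subspace of the Cantor space, sets being
   identified with their characteristic functions. *)
Definition cantor_subspace (F : set (set nat)) : topologicalType :=
  set_type [set x : cantor_space | F [set n | x n]].

Definition open_cover (T : topologicalType) (U : set (set T)) : Prop :=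
  U `<=` open /\ \bigcup_(V in U) V = [set: T].

Definition lindelof (T : topologicalType) : Prop :=
  forall U : set (set T), open_cover U ->
    exists F, [/\ F `<=` U, countable F & \bigcup_(V in F) V = [set: T]].

Definition menger (S : set (set nat)) (T : topologicalType) : Prop :=
  forall U : nat -> set (set T), (forall n, open_cover (U n)) ->
    exists F : nat -> set (set T),
      (forall n, F n `<=` U n /\ finite_set (F n)) /\
      forall x : T, S [set n | (\bigcup_(V in F n) V) x].

Definition productively (P : topologicalType -> Prop) (X : topologicalType) :
    Prop :=
  forall Y : topologicalType, P Y -> P (X * Y)%type.

(* Main.v *)
From HB Require Import structures.
Require Import Defs.
From mathcomp Require Import all_boot all_order all_algebra.
From mathcomp Require Import all_classical all_reals all_analysis.

(* Under CH a subset of P(N) not of cardinality at least b(cF) is countable, so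
   for every c : N -> N all but countably many x in X satisfy c(n) <= x(n), that
   is |x /\ [0, c(n))| <= n, for almost all n.

   Productively S-Menger: for fixed n, the sets with at most n elements form a
   compact subset of X u Fin. By a tube argument every y in Y has a neighbourhood
   V such that, for some k, {x : |x /\ [0, k)| <= n} x V is covered by finitely
   many members of the n-th cover. Applying the S-Menger property of Y to these V
   yields c(n) such that the chosen finite families serve every point (x, y) with
   |x /\ [0, c(n))| <= n for almost all n, hence all but countably many x; the
   exceptional fibres {x} x Y are copies of Y, and one more is handled at each
   stage n.

   Not productively Lindelof: let Y be P(N) with the points of X u Fin made
   isolated. Closed subsets of P(N) contained in X u Fin are countable, so Y is
   Lindelof, whereas the diagonal of (X u Fin) x Y is closed, discrete and
   uncountable. *)

Local Open Scope classical_set_scope.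
Local Open Scope card_scope.

Set Implicit Arguments.
Unset Strict Implicit.
Unset Printing Implicit Defensive.

(** * Finite and cofinite sets of naturals, semifilters, and diagonal bounds *)

Lemma finite_nat_bounded (A : set nat) : finite_set A ->
  exists N, forall n, A n -> (n < N)%N.
Proof.
move=> /finite_seqP[s ->]; exists (\max_(i <- s) i).+1 => n ns.
by rewrite ltnS (big_rem n) //= leq_maxl.
Qed.

Lemma cofinite_eventually (A : set nat) : cofinite_set A ->
  exists N, forall n, (N <= n)%N -> A n.
Proof.
move=> /finite_nat_bounded[N hN]; exists N => n Nn.
by apply: contrapT => /hN; rewrite ltnNge Nn.
Qed.

Lemma eventually_cofinite (A : set nat) N : (forall n, (N <= n)%N -> A n) ->
  cofinite_set A.
Proof.
move=> hN; apply: (@sub_finite_set _ _ `I_N); last exact: finite_II.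
by move=> n /= nA; rewrite ltnNge; apply/negP => /hN.
Qed.

(** Semifilters are upward closed only among infinite sets; here [t] is infinite because [s] is and
    [s] minus [t] is finite. *)
Lemma semifilter_almost_sub {S s t} N : semifilter S -> S s ->
  (forall n, (N <= n)%N -> s n -> t n) -> S t.
Proof.
move=> [Sinf Sup] Ss st.
have fst : finite_set (s `\` t).
  apply: (@sub_finite_set _ _ `I_N); last exact: finite_II.
  by move=> n [sn tn] /=; rewrite ltnNge; apply/negP => Nn; exact/tn/st.
apply: (Sup s) => // ft; apply: (Sinf _ Ss).
apply: (@sub_finite_set _ _ ((s `\` t) `|` t)).
  by move=> n sn; have [|] := pselect (t n); [right|left].
by rewrite finite_setU.
Qed.

Lemma countable_eventually_bounded {I : Type} (A : set I)
    (f : I -> nat -> nat) : countable A ->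
  exists c : nat -> nat, forall a, A a ->
    exists N, forall n, (N <= n)%N -> (f a n <= c n)%N.
Proof.
move=> /countable_injP[r rinj].
pose g i := xget (fun _ => 0%N) [set h | exists2 a, A a & r a = i /\ h = f a].
exists (fun n => \max_(i < n.+1) g i n)%N => a Aa; exists (r a) => n ran.
have -> : f a = g (r a).
  have : exists h, exists2 a', A a' & r a' = r a /\ h = f a' by exists (f a), a.
  move=> /(xgetPex (fun _ => 0%N)); rewrite -/(g (r a)) => -[b Ab [rab ->]].
  by congr f; apply: rinj => //; exact/mem_set.
by rewrite -ltnS in ran; rewrite (bigD1 (Ordinal ran)) //= leq_maxl.
Qed.

(** * Increasing enumerations and the sizes of initial traces *)

Lemma strict_mono_ge (e : nat -> nat) : {homo e : m n / (m < n)%N} ->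
  forall n, (n <= e n)%N.
Proof. by move=> eh; elim=> // n ih; exact: leq_ltn_trans ih (eh _ _ _). Qed.

(** The partial sums [g] of [c + 1] increase strictly and dominate [c]. The enumeration of their
    range is [g] composed with a strictly increasing [j], so it lies above [g]. *)
Lemma infinite_sparse (c : nat -> nat) :
  exists2 b, Ninf b & forall n, (c n <= incr_enum b n)%N.
Proof.
pose g n := (\sum_(i < n.+1) (c i).+1)%N.
have gS n : (g n < g n.+1)%N.
  by rewrite {2}/g big_ord_recr /= -/(g n) -addSnnS leq_addr.
have gh : {homo g : m n / (m < n)%N} by apply: homo_ltn => //; exact: ltn_trans.
have gm m n : (g m < g n)%N -> (m < n)%N.
  move=> h; rewrite ltnNge; apply/negP; rewrite leq_eqVlt => /predU1P[nm|/gh nm].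
    by rewrite nm ltnn in h.
  by move: (ltn_trans h nm); rewrite ltnn.
have binf : Ninf (range g).
  move=> /finite_nat_bounded[N /(_ (g N))]; have /[swap]/[apply] : range g (g N) by exists N.
  by rewrite ltnNge strict_mono_ge.
exists (range g) => // n.
have [eh er] := incr_enumP binf.
have /choice[j jP] : forall m, exists j, g j = incr_enum (range g) m.
  move=> m; have [j _ gj] : range g (incr_enum (range g) m) by rewrite -[X in X _]er; exists m.
  by exists j.
have jh : {homo j : m n / (m < n)%N}.
  by move=> m p mp; apply: gm; rewrite !jP; exact: eh.
have cg m : (c m <= g m)%N by rewrite /g big_ord_recr /= addnS ltnW // ltnS leq_addl.
apply: leq_trans (cg n) _; rewrite -jP.
by have := strict_mono_ge jh n; rewrite leq_eqVlt => /predU1P[<-//|/gh/ltnW].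
Qed.

Definition trace_size (x : nat -> bool) (k : nat) : nat := count x (iota 0 k).

Lemma trace_size_mono (x : nat -> bool) k l : (k <= l)%N ->
  (trace_size x k <= trace_size x l)%N.
Proof. by move=> kl; rewrite /trace_size -(subnKC kl) iotaD count_cat leq_addr. Qed.

(** The elements of x below x(n) are among x(0), ..., x(n-1). *)
Lemma trace_size_enum (x : nat -> bool) n k : Ninf [set i | x i] ->
  (k <= incr_enum [set i | x i] n)%N -> (trace_size x k <= n)%N.
Proof.
move=> xinf kn; have [eh er] := incr_enumP xinf.
rewrite /trace_size -size_filter -[leqRHS](size_iota 0).
rewrite -(size_map (incr_enum [set i | x i]) (iota 0 n)).
apply: uniq_leq_size => [|i]; first exact: filter_uniq (iota_uniq _ _).
rewrite mem_filter mem_iota /= add0n => /andP[xi ik].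
have [j _ ji] : range (incr_enum [set i | x i]) i by rewrite er.
apply/mapP; exists j => //; rewrite mem_iota /= add0n ltnNge; apply/negP.
rewrite leq_eqVlt => /predU1P[nj|/eh].
  by move: ik; rewrite -ji -nj ltnNge kn.
by rewrite ji => /(leq_ltn_trans kn); rewrite ltnNge (ltnW ik).
Qed.

Lemma trace_size_finite (x : nat -> bool) :
  finite_set [set i | x i] <-> exists N, forall k, (trace_size x k <= N)%N.
Proof.
split=> [/finite_seqP[F FA]|[N hN] ].
  exists (size F) => k; rewrite /trace_size -size_filter.
  apply: uniq_leq_size => [|i]; first exact: filter_uniq (iota_uniq _ _).
  rewrite mem_filter => /andP[xi _].
  suff: [set` F] i by [].
  by rewrite -FA.
apply: contrapT => xinf; have [eh er] := incr_enumP xinf.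
(* The [N.+1] elements x(0), ..., x(N) all lie below x(N) + 1. *)
have := hN (incr_enum [set i | x i] N).+1; rewrite leqNgt => /negP; apply.
rewrite /trace_size -size_filter.
have <- : size (map (incr_enum [set i | x i]) (iota 0 N.+1)) = N.+1 by rewrite size_map size_iota.
apply: uniq_leq_size => [|i].
  rewrite map_inj_uniq ?iota_uniq // => a b ab; apply/eqP; rewrite eqn_leq.
  by apply/andP; split; rewrite leqNgt; apply/negP => /eh; rewrite ab ltnn.
move=> /mapP[j]; rewrite mem_iota => /andP[_]; rewrite add0n => jN ->.
rewrite mem_filter mem_iota /= add0n; apply/andP; split.
  have : range (incr_enum [set i | x i]) (incr_enum [set i | x i] j) by exists j.
  by rewrite er.
by move: jN; rewrite !ltnS leq_eqVlt => /predU1P[->//|/eh/ltnW].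
Qed.

(** * Cardinality consequences of the scale hypothesis *)

Lemma countable_inj_preimage (T U : Type) (f : T -> U) (B : set U) :
  injective f -> countable B -> countable [set x | B (f x)].
Proof.
move=> finj /countable_injP[g ginj]; apply/countable_injP; exists (g \o f).
move=> x y /set_mem Bx /set_mem By /= gxy; apply: finj.
by apply: ginj gxy; exact/mem_set.
Qed.

Lemma trace_inj : injective (fun x : cantor_space => [set n | x n]).
Proof.
move=> x y xy; apply/funext => n; apply/idP/idP => h.
  by have : [set n | x n] n by []; rewrite xy.
by have : [set n | y n] n by []; rewrite -xy.
Qed.

Lemma cF_scale_concentrated X (c : nat -> nat) : CH -> cofinal_scale cF X ->
  countable [set x : cantor_space | X [set n | x n] /\
    ~ exists N, forall n, (N <= n)%N -> (trace_size x (c n) <= n)%N].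
Proof.
move=> ch [Xinf [B [_ _ Bscale]]]; have [b binf cb] := infinite_sparse c.
have : countable [set a | X a /\ ~ leS cF b a].
  (* An exceptional set equipotent with P(N) would admit an injection of [B], which the scale
     property forbids. *)
  have [//|/card_eqPle[_ le]] := ch [set a | X a /\ ~ leS cF b a].
  have /negP[] := Bscale b binf; apply: card_le_trans le.
  exact: subset_card_le.
move=> /(countable_inj_preimage trace_inj); apply: sub_countable.
apply: subset_card_le => x [Xx nb]; split=> // bx; apply: nb.
have [N hN] := cofinite_eventually bx; exists N => n Nn.
apply: trace_size_enum; first exact: Xinf.
exact: leq_trans (cb n) (hN n Nn).
Qed.

(** Since b(cF) is at most |X|, a countable [X] would give a countable unbounded [B]; but countably
    many enumerations have a common eventual bound. *)
Lemma cF_scale_uncountable X : cofinal_scale cF X ->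
  ~ countable [set x : cantor_space | X [set n | x n]].
Proof.
move=> [Xinf [B [[[Binf Bunb] _] BX _]]] cX; apply: Bunb.
have cB : countable B.
  apply: sub_countable BX _; apply: sub_countable cX.
  apply: card_le_trans (card_image_le (fun x : cantor_space => [set n | x n]) _).
  apply: subset_card_le => a Xa; have ea : [set n | (fun n => `[< a n >]) n] = a.
    by apply/funext => n; exact: asboolE.
  by exists (fun n => `[< a n >]); rewrite /= ea.
have [c hc] := countable_eventually_bounded incr_enum cB.
have [b binf cb] := infinite_sparse c; exists b => // a /hc[N hN].
apply: (@eventually_cofinite _ N) => n /hN h; exact: leq_trans h (cb n).
Qed.

(** * Cylinders and compactness of the Cantor space *)

Definition cylinder (x : cantor_space) (m : nat) : set cantor_space :=
  [set y | forall i, (i < m)%N -> y i = x i].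

Lemma cylinder_open x m : open (cylinder x m).
Proof.
elim: m => [|m ih].
  by rewrite (_ : cylinder x 0 = setT); [exact: openT|apply/seteqP; split].
have -> : cylinder x m.+1 = cylinder x m `&` (fun y : cantor_space => y m) @^-1` [set x m].
  apply/seteqP; split => [y h|y [h hm] i]; first by split=> [i im|]; apply: h => //; exact: ltnW.
  by rewrite ltnS leq_eqVlt => /predU1P[->//|]; exact: h.
apply: openI => //; apply: open_comp; last exact: discrete_open.
by move=> y _; exact: (@proj_continuous nat (fun=> bool) m y).
Qed.

Lemma cylinder_sub x y m : cylinder x m y -> cylinder y m `<=` cylinder x m.
Proof. by move=> xy z yz i im; rewrite yz // xy. Qed.

Lemma cylinder_closed x m : closed (cylinder x m).
Proof.
rewrite -openC openE => y /= nxy; apply: (@filterS _ _ _ (cylinder y m)).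
  by move=> z yz xz; apply: nxy => i im; rewrite -xz // yz.
by apply: open_nbhs_nbhs; split => //; exact: cylinder_open.
Qed.

Lemma cylinder_mono x m p : (m <= p)%N -> cylinder x p `<=` cylinder x m.
Proof. by move=> mp y h i im; apply: h; exact: leq_trans mp. Qed.

Lemma nbhs_cylinder (x : cantor_space) A : nbhs x A ->
  exists m, cylinder x m `<=` A.
Proof.
rewrite nbhsE => -[G [Go Gx] GA].
(* The cylinders at [x] meet only in [x], so [G] and their complements cover the space; by a finite
   subcover, a deep enough cylinder lies in [G]. *)
have := cantor_space_compact; rewrite compact_cover.
move=> /(_ nat setT (fun m => G `|` ~` cylinder x m)) [|y _|D _ Dc].
- by move=> m _; apply: openU => //; rewrite openC; exact: cylinder_closed.
- have [->|xy] := pselect (y = x); first by exists 0%N => //; left.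
  have [m xym] : exists m, y m <> x m.
    apply: contrapT => h; apply: xy; apply/funext => m.
    by apply: contrapT => ?; apply: h; exists m.
  by exists m.+1 => //; right => /(_ m (ltnSn m)).
have [N hN] := finite_nat_bounded (finite_fset D).
exists N => y xy; apply: GA; have [m Dm [//|[]]] := Dc y I.
exact: cylinder_mono (ltnW (hN m Dm)) _ xy.
Qed.

Lemma trace_size_cylinder x m k y : (k <= m)%N -> cylinder x m y ->
  trace_size y k = trace_size x k.
Proof.
move=> km xy; apply: eq_in_count => i; rewrite mem_iota add0n => /andP[_ ik].
by apply: xy; exact: leq_trans km.
Qed.

Lemma cylinder_finite_cover (m : cantor_space -> nat) :
  exists s : seq cantor_space, forall y, exists2 x, x \in s & cylinder x (m x) y.
Proof.
have := cantor_space_compact; rewrite compact_cover.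
move=> /(_ cantor_space setT (fun x => cylinder x (m x)))[x _|x _|D _ Dc].
- exact: cylinder_open.
- by exists x.
have /finite_seqP[s sD] := finite_fset D; exists s => y.
have [x Dx xy] := Dc y I; exists x => //.
suff: [set` s] x by [].
by rewrite -sD.
Qed.

(** * Products with an S-Menger space *)

Definition finitely_covered (T : Type) (U : set (set T)) (A : set T) : Prop :=
  exists F, [/\ F `<=` U, finite_set F & A `<=` \bigcup_(W in F) W].

(** The admissible sets [V] form covers of [Y]; among the finitely many selected at stage [n], [b n]
    bounds all their [k]. It serves both for the sets of small trace and, with [A] a constant
    singleton, for a single fibre. *)
Lemma menger_select S (T : Type) (Y : topologicalType) (A : nat -> nat -> set T)
    (U : nat -> set (set (T * Y))) : semifilter S -> menger S Y ->
  (forall n k l, (k <= l)%N -> A n l `<=` A n k) ->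
  (forall n y, exists k V,
    [/\ open V, V y & finitely_covered (U n) (A n k `*` V)]) ->
  exists (b : nat -> nat) (F : nat -> set (set (T * Y))),
    (forall n, F n `<=` U n /\ finite_set (F n)) /\
    forall y, S [set n | A n (b n) `*` [set y] `<=` \bigcup_(W in F n) W].
Proof.
move=> Ssf mY Amono loc.
pose C n := [set V : set Y | open V /\
  exists k, finitely_covered (U n) (A n k `*` V)].
have Ccov n : open_cover (C n).
  split=> [V []//|]; apply/seteqP; split=> // y _.
  have [k [V [Vo Vy fc]]] := loc n y.
  by exists V => //; split=> //; exists k.
have [G [GC GS]] := mY C Ccov.
have /choice[kH HP] (nV : nat * set Y) :
    exists kH : nat * set (set (T * Y)), C nV.1 nV.2 ->
      [/\ kH.2 `<=` U nV.1, finite_set kH.2 &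
          A nV.1 kH.1 `*` nV.2 `<=` \bigcup_(W in kH.2) W].
  have [[_ [k [H HP]]]|nC] := pselect (C nV.1 nV.2); first by exists (k, H).
  by exists (0%N, set0).
have /choice[b bP] n : exists b, forall V, G n V -> ((kH (n, V)).1 <= b)%N.
  have [b hb] := finite_nat_bounded (finite_image (fun V => (kH (n, V)).1) (GC n).2).
  by exists b => V GV; apply/ltnW/hb; exists V.
exists b, (fun n => \bigcup_(V in G n) (kH (n, V)).2); split=> [n|y].
  split=> [W [V GV]|]; first by have [+ _ _] := HP (n, V) ((GC n).1 _ GV); apply.
  apply: bigcup_finite => [|V GV]; first exact: (GC n).2.
  by have [] := HP (n, V) ((GC n).1 _ GV).
apply: (semifilter_almost_sub (N := 0%N) Ssf (GS y)).
move=> n _ [V GV Vy] [t _] [/= At ->].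
have [_ _ /(_ (t, y))[|W HW Wty]] := HP (n, V) ((GC n).1 _ GV).
  by split=> //; exact: Amono (bP n V GV) _ At.
by exists W => //; exists V.
Qed.

Definition pt F (t : cantor_subspace F) : cantor_space := set_val t.

Lemma pt_nbhs F (t : cantor_subspace F) A : nbhs t A ->
  exists m, forall t', cylinder (pt t) m (pt t') -> A t'.
Proof.
rewrite nbhsE => -[_ [[G Go <-] Gt] GA].
have [|m mG] := @nbhs_cylinder (pt t) G; first exact: open_nbhs_nbhs.
by exists m => t' /mG ?; exact: GA.
Qed.

Lemma nbhs_prodP (T Y : topologicalType) (p : T * Y) A : nbhs p A ->
  exists P V, [/\ nbhs p.1 P, open V, V p.2 & P `*` V `<=` A].
Proof.
move=> [[P Q] /= [hP]]; rewrite nbhsE => -[V [Vo Vy] VQ PQ].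
by exists P, V; split=> // -[t y] [Pt /VQ Qy]; exact: PQ.
Qed.

(* The sets {t | trace_size t k <= n} shrink, as k grows, to the compact set of
   the sets with at most n elements, so this is a tube lemma. *)
Lemma trace_size_tube F (Y : topologicalType)
    (U : set (set (cantor_subspace F * Y))) n y :
  Nfin `<=` F -> open_cover U -> exists k V, [/\ open V, V y &
    finitely_covered U ([set t | (trace_size (pt t) k <= n)%N] `*` V)].
Proof.
move=> finF [Uo Ucov].
have /choice[/=  kVF H] (x : cantor_space) : exists kVF : nat * set Y * (nat * set (set (cantor_subspace F * Y))),
    [/\ open kVF.1.2, kVF.1.2 y, kVF.2.2 `<=` U, finite_set kVF.2.2 &
      [set t | cylinder x kVF.2.1 (pt t) /\ (trace_size (pt t) kVF.1.1 <= n)%N] `*` kVF.1.2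
        `<=` \bigcup_(W in kVF.2.2) W].
  (* If [x] has more than [n] elements, then for some [k] no point of the cylinder of depth [k] has
     trace at most [n], and the empty family suffices. Otherwise [x] is finite, hence a point of the
     subspace. *)
  have [xn|] := pselect (forall k, (trace_size x k <= n)%N); last first.
    move=> /existsNP[k /negP]; rewrite -ltnNge => nk.
    exists ((k, setT), (k, set0)); split=> //=; first exact: openT.
    move=> [t v] /= [[xt tn] _]; move: tn.
    by rewrite (trace_size_cylinder (leqnn k) xt) leqNgt nk.
  have Fx : F [set i | x i] by apply: finF; apply/trace_size_finite; exists n.
  pose t0 : cantor_subspace F := exist _ x (mem_set Fx).
  have : (\bigcup_(W in U) W) (t0, y) by rewrite Ucov.
  move=> [W UW Wty].
  have /nbhs_prodP[P [V [/pt_nbhs[m mP] Vo Vy PVW]]] : nbhs (t0, y) W.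
    by apply: open_nbhs_nbhs; split=> //; exact: Uo.
  exists ((0%N, V), (m, [set W])); split=> //=; first by move=> _ ->.
  move=> [t v] /= [[xt _] Vv]; exists W => //; apply: PVW; split=> //=.
  exact: mP.
have [s sP] := cylinder_finite_cover (fun x => (kVF x).2.1).
have sfin : finite_set [set` s] by apply/finite_seqP; exists s.
(* Having at most [n] elements below this [k] implies the same below each local threshold. *)
have [k kP] := finite_nat_bounded (finite_image (fun x => (kVF x).1.1) sfin).
exists k, (\bigcap_(x in [set` s]) (kVF x).1.2); split.
- rewrite bigcap_seq; elim/big_ind: _ => [|A B|x _]; [exact: openT|exact: openI|].
  by have [] := H x.
- by move=> x _; have [] := H x.
exists (\bigcup_(x in [set` s]) (kVF x).2.2); split.
- by move=> W [x _]; have [_ _ + _ _] := H x; apply.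
- by apply: bigcup_finite => // x _; have [] := H x.
move=> [t v] /= [tn tV]; have [x sx xt] := sP (pt t).
have [_ _ _ _ /(_ (t, v))[|W FW Wtv]] := H x.
  split=> /=; last exact: tV.
  split=> //; apply: leq_trans tn; apply: trace_size_mono; apply: ltnW.
  by apply: kP; exists x.
by exists W => //; exists x.
Qed.

Lemma productively_menger S X :
  semifilter S ->
  (forall c : nat -> nat, countable [set x : cantor_space | X [set n | x n] /\
    ~ exists N, forall n, (N <= n)%N -> (trace_size x (c n) <= n)%N]) ->
  productively (menger S) (cantor_subspace (X `|` Nfin)).
Proof.
move=> Ssf conc Y mY U Ucov; set T := cantor_subspace _ in U Ucov *.
have [||b [F [FU FS]]] := menger_select (A := fun n k => [set t : T | (trace_size (pt t) k <= n)%N]) (U := U) Ssf mY.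
- by move=> n k l kl t /=; apply: leq_trans; exact: trace_size_mono.
- by move=> n y; apply: trace_size_tube => //; exact: subsetUr.
have /choice[H HP] (z : T) : exists H : nat -> set (set (T * Y)),
    (forall n, H n `<=` U n /\ finite_set (H n)) /\
    forall y, S [set n | (\bigcup_(W in H n) W) (z, y)].
  have [||_ [H [HU HS]]] := menger_select (A := fun _ _ => [set z]) (U := U) Ssf mY.
    by move=> n k l _ x.
    move=> n y; exists 0%N.
    have : (\bigcup_(W in U n) W) (z, y) by rewrite (Ucov n).2.
    move=> [W UW Wzy].
    have /nbhs_prodP[P [V [/nbhs_singleton Pz Vo Vy PVW]]] : nbhs (z, y) W.
      by apply: open_nbhs_nbhs; split=> //; exact: (Ucov n).1.
    exists V; split=> //; exists [set W]; split=> //; first by move=> _ ->.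
    by move=> [_ v] [/= -> Vv]; exists W => //; exact: PVW.
  exists H; split=> // y; apply: (semifilter_almost_sub (N := 0%N) Ssf (HS y)).
  by move=> n _; apply.
set bad := [set x : cantor_space | X [set n | x n] /\
  ~ exists N, forall n, (N <= n)%N -> (trace_size x (b n) <= n)%N].
have /countable_injP[r rinj] : countable [set t : T | bad (pt t)].
  by apply: countable_inj_preimage (conc b); exact: val_inj.
(* As [r] is injective on the bad points, [E i] has at most one element, so stage [n] adds the
   families of only finitely many fibres; the fibre over [z] is served from stage [r z] on. *)
pose E i := [set z : T | bad (pt z) /\ r z = i].
exists (fun n => F n `|` \bigcup_(i in `I_n.+1) \bigcup_(z in E i) H z n); split=> [n|[z y]].
  split.
    by move=> W [|[i _ [z _]]]; [exact: (FU n).1|exact: ((HP z).1 n).1].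
  rewrite finite_setU; split; first exact: (FU n).2.
  apply: bigcup_finite => // i _; apply: bigcup_finite => [|z _]; last exact: ((HP z).1 n).2.
  have [->//|/set0P[z [bz rz]]] := eqVneq (E i) set0.
  apply: (@sub_finite_set _ _ [set z]) => // w [bw rw] /=.
  by apply: rinj; [exact/mem_set|exact/mem_set|rewrite rz rw].
have [bz|nbz] := pselect (bad (pt z)).
  apply: (semifilter_almost_sub (N := r z) Ssf ((HP z).2 y)) => n zn [W HW Wzy].
  by exists W => //; right; exists (r z) => //; exists z.
have [N hN] : exists N, forall n, (N <= n)%N -> (trace_size (pt z) (b n) <= n)%N.
  have [Xz|] : (X `|` Nfin) [set n | pt z n] by exact: (set_mem (valP z)).
    by apply: contrapT => h; exact: nbz.
  move=> /trace_size_finite[N hN]; exists N => n; exact: leq_trans (hN _).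
apply: (semifilter_almost_sub (N := N) Ssf (FS y)) => n Nn /(_ (z, y))[].
  by split=> //; exact: hN.
by move=> W FW Wzy; exists W => //; left.
Qed.

(** * Condensation points and countability of closed subsets *)

(** Coding by bit strings shows that there are only countably many cylinders. *)
Lemma cylinder_code x m :
  exists s : seq bool, cylinder x m = cylinder (nth false s) (size s).
Proof.
exists (mkseq x m); rewrite size_mkseq.
by apply/seteqP; split=> y xy i im; rewrite xy // nth_mkseq.
Qed.

Lemma countable_finite_points :
  countable [set x : cantor_space | finite_set [set n | x n]].
Proof.
apply: (@sub_countable _ _ _ (range (nth false : seq bool -> nat -> bool))).
  apply: subset_card_le => x /finite_nat_bounded[N hN]; exists (mkseq x N) => //.
  apply/funext => i; have [iN|Ni] := ltnP i N; first by rewrite nth_mkseq.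
  rewrite nth_default ?size_mkseq //; apply/esym/negP => /hN.
  by rewrite ltnNge Ni.
by apply: sub_countable (card_image_le _ _) _; exact: countableP.
Qed.

Lemma uncountable_exists (T : Type) (A B : set T) :
  ~ countable A -> countable B -> exists x, A x /\ ~ B x.
Proof.
move=> nA cB; apply: contrapT => h; apply: nA; apply: sub_countable cB.
apply: subset_card_le => x Ax; apply: contrapT => nBx; apply: h.
by exists x.
Qed.

Definition condensation (K : set cantor_space) : set cantor_space :=
  [set x | K x /\ forall m, ~ countable (K `&` cylinder x m)].

(** Each discarded point lies in one of the countably many cylinders that meet [K] in a countable
    set. *)
Lemma countable_condensationD K : countable (K `\` condensation K).
Proof.
apply: (@sub_countable _ _ _ (\bigcup_(s in [set s : seq bool | countable (K `&` cylinder (nth false s) (size s))])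
  (K `&` cylinder (nth false s) (size s)))); last first.
  by apply: bigcup_countable => //; exact: countableP.
apply: subset_card_le => x [Kx /not_andP[//|/existsNP[m /contrapT cm]]].
have [s sE] := cylinder_code x m; exists s; first by rewrite /= -sE.
by split=> //; rewrite -sE.
Qed.

Lemma condensation_uncountable K x m : condensation K x ->
  ~ countable (condensation K `&` cylinder x m).
Proof.
move=> [_ /(_ m) nc] cc; apply: nc.
apply: (@sub_countable _ _ _ (\bigcup_(b in [set: bool])
  if b then K `\` condensation K else condensation K `&` cylinder x m)).
  apply: subset_card_le => y [Ky xy].
  by have [cy|ncy] := pselect (condensation K y); [exists false|exists true].
apply: bigcup_countable => [|[] _]; [exact: countableP| |exact: cc].
exact: countable_condensationD.
Qed.

Lemma cylinder_limit (q : nat -> cantor_space * nat) :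
  (forall i, (q i).2 < (q i.+1).2)%N ->
  (forall i, cylinder (q i).1 (q i).2 (q i.+1).1) ->
  exists x, forall i, cylinder (q i).1 (q i).2 x.
Proof.
move=> qm qc.
have qmm i j : (i <= j)%N -> ((q i).2 <= (q j).2)%N.
  by move=> ij; apply: (homo_leq (f := fun i => (q i).2) leqnn leq_trans) ij => k; exact: ltnW.
have qge i : (i <= (q i).2)%N by elim: i => // i ih; exact: leq_ltn_trans ih (qm i).
have qcc i j : (i <= j)%N -> cylinder (q i).1 (q i).2 (q j).1.
  move=> /subnKC <-; elim: (j - i)%N => [|d ih]; first by rewrite addn0.
  rewrite addnS; apply: (cylinder_sub ih).
  by apply: (cylinder_mono (qmm _ _ (leq_addr d i))); exact: qc.
(* The depth at stage [l.+1] exceeds [l], so coordinate [l] is fixed from then on. *)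
exists (fun l => (q l.+1).1 l) => i l li.
have <- : (q (maxn i l.+1)).1 l = (q l.+1).1 l.
  by apply: qcc (leq_maxr _ _) _ _; exact: qge.
by apply: qcc (leq_maxl _ _) _ _.
Qed.

(** Choose one infinite condensation point in every cylinder that has one. These are countably many,
    so a single [c] eventually dominates, for each of them, a function giving a length at which the
    trace exceeds [n]. *)
Lemma dominated_generic (K : set cantor_space) :
  exists c : nat -> nat, forall p m, condensation K p -> exists y N,
    [/\ condensation K y, cylinder p m y &
        forall n, (N <= n)%N -> (n < trace_size y (c n))%N].
Proof.
have /choice[h hP] (yn : cantor_space * nat) : exists k,
    ~ finite_set [set i | yn.1 i] -> (yn.2 < trace_size yn.1 k)%N.
  have [fin|inf] := pselect (finite_set [set i | yn.1 i]); first by exists 0%N.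
  apply: contrapT => /forallNP hk; apply: inf; apply/trace_size_finite.
  exists yn.2 => k; rewrite leqNgt; apply/negP => lt; exact: (hk k (fun=> lt)).
have /choice[Y YP] (s : seq bool) : exists y, forall z,
    condensation K z -> cylinder (nth false s) (size s) z ->
    ~ finite_set [set i | z i] ->
    [/\ condensation K y, cylinder (nth false s) (size s) y & ~ finite_set [set i | y i]].
  have [[y yP]|no] := pselect (exists y, [/\ condensation K y,
    cylinder (nth false s) (size s) y & ~ finite_set [set i | y i]]).
    by exists y.
  by exists point => z z1 z2 z3; case: no; exists z.
have [c cP] := countable_eventually_bounded (fun s n => h (Y s, n))
  (countableP [set: seq bool]).
exists c => p m /(condensation_uncountable (m := m)).
(* Finite sets are only countably many, so the cylinder contains an infinite condensation point. *)
move=> /uncountable_exists/(_ countable_finite_points)[z [[Kz pz] zinf]].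
have [s sE] := cylinder_code p m; have [N hN] := cP s I.
have [|Ky sy yinf] := YP s z Kz _ zinf; first by rewrite -sE.
exists (Y s), N; split=> //; first by rewrite sE.
move=> n /hN/(trace_size_mono (Y s)); apply: leq_trans.
exact: (hP (Y s, n)).
Qed.

(* A closed uncountable K would contain, by a Baire category argument inside
   its condensation points, an infinite x outside the countable exceptional set
   of some c and yet with x(n) < c(n) for infinitely many n. *)
Lemma concentrated_closed_countable (A K : set cantor_space) :
  (forall c : nat -> nat, countable [set x | A x /\
    ~ exists N, forall n, (N <= n)%N -> (trace_size x (c n) <= n)%N]) ->
  closed K -> K `<=` A `|` [set x | finite_set [set n | x n]] -> countable K.
Proof.
move=> conc Kcl KA; apply: contrapT => Kunc.
have [c cP] := dominated_generic K.
set bad := [set x | A x /\ ~ exists N, forall n, (N <= n)%N -> (trace_size x (c n) <= n)%N].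
have /countable_injP[r rinj] : countable bad := conc c.
have /choice[z zP] (i : nat) : exists z, forall x, bad x -> r x = i -> x = z.
  have [[z [bz rz]]|no] := pselect (exists z, bad z /\ r z = i).
    by exists z => x bx rx; apply: rinj; [exact/mem_set|exact/mem_set|rewrite rz].
  by exists point => x bx rx; case: no; exists x.
(* One Baire step: shrink the cylinder to avoid the bad point coded by [i] and to force trace
   greater than [n] below [c n] for some [n] at least [i]. *)
have /choice[/= step stepP] (iq : nat * (cantor_space * nat)) :
    exists q' : cantor_space * nat, condensation K iq.2.1 ->
    [/\ condensation K q'.1, (iq.2.2 < q'.2)%N, cylinder iq.2.1 iq.2.2 q'.1,
        ~ cylinder q'.1 q'.2 (z iq.1) &
        forall x, cylinder q'.1 q'.2 x ->
          exists n, (iq.1 <= n)%N /\ (n < trace_size x (c n))%N].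
  case: iq => i [p m] /=.
  have [Kp|] := pselect (condensation K p); last by exists (p, m).
  have [w [[Kw pw] wz]] := uncountable_exists
    (condensation_uncountable (m := m) Kp) (countable1 (z i)).
  have [j wj] : exists j, w j <> z i j.
    by apply: contrapT => /forallNP h; apply: wz; apply/funext => j; exact: contrapT (h j).
  have [y [N [Ky wy yN]]] := cP w (maxn j.+1 m) Kw.
  (* Depth [c n] freezes the trace below [c n], depth [j.+1] keeps the difference from [z i] at [j],
     and [m.+1] makes the depths increase. *)
  pose n := maxn N i; pose m' := maxn (c n) (maxn j.+1 m.+1).
  have jm' : (j < m')%N by rewrite !leq_max leqnn orbT.
  exists (y, m') => _; split=> //=.
  - by rewrite !leq_max leqnn !orbT.
  - apply: cylinder_sub pw _ _; apply: cylinder_mono wy; exact: leq_maxr.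
  - by move=> /(_ j jm') zj; apply: wj; rewrite zj wy // leq_max leqnn.
  - move=> x yx; exists n; split; first exact: leq_maxr.
    rewrite (trace_size_cylinder _ yx) ?leq_maxl //; apply: yN.
    exact: leq_maxl.
have [p0 Kp0] : condensation K !=set0.
  apply: contrapT => no; apply: Kunc.
  apply: sub_countable (countable_condensationD K).
  by apply: subset_card_le => x Kx; split=> // ?; apply: no; exists x.
pose q := fix q i := if i is i'.+1 then step (i', q i') else (p0, 0%N).
have Kq i : condensation K (q i).1.
  by elim: i => //= i ih; have [] := stepP (i, q i) ih.
have [x xP] : exists x, forall i, cylinder (q i).1 (q i).2 x.
  by apply: cylinder_limit => i; have [] := stepP (i, q i) (Kq i).
have qge i : (i <= (q i).2)%N.
  elim: i => // i ih; apply: leq_ltn_trans ih _.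
  by have [] := stepP (i, q i) (Kq i).
have Kx : K x.
  apply: Kcl => B /nbhs_cylinder[m mB]; exists (q m).1; split; first by have [] := Kq m.
  by apply: mB => i im; rewrite (xP m) //; exact: leq_trans im (qge m).
have large i : exists n, (i <= n)%N /\ (n < trace_size x (c n))%N.
  by have [_ _ _ _] := stepP (i, q i) (Kq i); apply; exact: xP i.+1.
have nbad : ~ bad x.
  move=> /zP/(_ erefl) xz; have [_ _ _ + _] := stepP (r x, q (r x)) (Kq (r x)).
  by apply; rewrite /= -xz; exact: xP (r x).+1.
(* Traces exceeding [n] below [c n] for arbitrarily large [n] would make [x] bad if in [A], and
   exclude that [x] is finite. *)
have [Ax|/trace_size_finite[N hN]] := KA x Kx.
  apply: nbad; split=> // -[N hN]; have [n [/hN le]] := large N.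
  by rewrite ltnNge le.
have [n [Nn]] := large N.
by rewrite ltnNge (leq_trans (hN _) Nn).
Qed.

(** * Isolating the points of a set, as in the Michael line *)

(** An alias of [T], so that a second topology can be put on the same points: those of [A] become
    isolated, the others keep their neighbourhoods. *)
Definition michael (T : topologicalType) (A : set T) : Type := T.

Section MichaelTopology.
Variables (T : topologicalType) (A : set T).

Definition michael_open : set_system (michael A) :=
  [set G | forall x : T, G x -> ~ A x -> nbhs x G].

Let michael_openT : michael_open setT.
Proof. by move=> x _ _; exact: filterT. Qed.

Let michael_openI : setI_closed michael_open.
Proof.
by move=> G H Go Ho x [Gx Hx] Ax; apply: filterI; [exact: Go|exact: Ho].
Qed.

Let michael_open_bigU (I : Type) (G : I -> set T) :
  (forall i, michael_open (G i)) -> michael_open (\bigcup_i G i).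
Proof.
move=> Go x [i _ Gx] Ax; apply: filterS (Go i x Gx Ax) => y Gy.
by exists i.
Qed.

HB.instance Definition _ := Choice.copy (michael A) T.
HB.instance Definition _ := isOpenTopological.Build (michael A)
  michael_openT michael_openI michael_open_bigU.

End MichaelTopology.

Lemma open_michael (T : topologicalType) (A : set T) (G : set T) :
  open (G : set (michael A)) <-> michael_open (A := A) G.
Proof. by []. Qed.

Lemma michael_isolated (T : topologicalType) (A : set T) (x : michael A) :
  A x -> nbhs x [set x].
Proof.
by move=> Ax; apply: open_nbhs_nbhs; split=> //; apply/open_michael => _ ->.
Qed.

Lemma nbhs_michael (T : topologicalType) (A : set T) (x : T) (G : set T) :
  nbhs x G -> nbhs (x : michael A) G.
Proof.
rewrite nbhsE => -[H [Ho Hx] HG]; have : nbhs (x : michael A) H.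
  apply: open_nbhs_nbhs; split=> //; apply/open_michael => y Hy _.
  by apply: open_nbhs_nbhs; split.
exact: (@filterS _ (nbhs (x : michael A)) _ _ _ HG).
Qed.

(** The cylinders contained in a member of the cover are countably many and contain all points
    outside [A]. What they miss is closed and inside [A], hence countable, and is covered point by
    point. *)
Lemma lindelof_michael (A : set cantor_space) :
  (forall K, closed K -> K `<=` A -> countable K) -> lindelof (michael A).
Proof.
move=> Acl U [Uo Ucov].
pose cyl (s : seq bool) : set cantor_space := cylinder (nth false s) (size s).
pose good (s : seq bool) := exists2 V, U V & cyl s `<=` V.
have /choice[f fP] (s : seq bool) : exists V, good s -> U V /\ cyl s `<=` V.
  have [[V UV sV]|no] := pselect (good s); first by exists V.
  by exists set0.
have /choice[g gP] (x : michael A) : exists V, U V /\ V x.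
  have : (\bigcup_(V in U) V) x by rewrite Ucov.
  by move=> [V UV Vx]; exists V.
pose K : set cantor_space := ~` \bigcup_(s in good) cyl s.
have cK : countable K.
  apply: Acl; first by apply: open_closedC; apply: bigcup_open => s _; exact: cylinder_open.
  move=> x Kx; apply: contrapT => nAx; apply: Kx.
  have [Ux xU] := gP x.
  have [m mV] := nbhs_cylinder ((open_michael _ _).1 (Uo _ Ux) x xU nAx).
  have [s sE] := cylinder_code x m; exists s; last by rewrite /cyl -sE.
  by exists (g x) => //; rewrite /cyl -sE.
exists (f @` good `|` g @` K); split.
- by move=> V [[s /fP[UV _] <-]|[x _ <-]] //; exact: (gP x).1.
- apply: (@sub_countable _ _ _ (\bigcup_(b in [set: bool]) if b then f @` good else g @` K)).
    by apply: subset_card_le => V [h|h]; [exists true|exists false].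
  apply: bigcup_countable => [|[] _]; first exact: countableP.
    by apply: sub_countable (card_image_le _ _) _; exact: countableP.
  exact: sub_countable (card_image_le _ _) cK.
- apply/seteqP; split=> // x _.
  have [[s gs sx]|Kx] := pselect ((\bigcup_(s in good) cyl s) x).
    by exists (f s); [left; exists s|exact: (fP s gs).2].
  by exists (g x); [right; exists x|exact: (gP x).2].
Qed.

Lemma pt_cylinder_nbhs F (t : cantor_subspace F) m :
  nbhs t [set t' | cylinder (pt t) m (pt t')].
Proof.
apply: open_nbhs_nbhs; split=> //.
by exists (cylinder (pt t) m) => //; exact: cylinder_open.
Qed.

(** The complement [W] of the diagonal and the open slices [O x] form a cover in which the diagonal
    point over [x] lies in [O x] alone, so a subcover keeps every slice. *)
Lemma michael_diagonal_not_lindelof F :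
  ~ countable [set x : cantor_space | F [set n | x n]] ->
  ~ lindelof (cantor_subspace F *
              michael [set x : cantor_space | F [set n | x n]])%type.
Proof.
set A := [set x | _] => Aunc; set Y := michael A.
have [x0 [Ax0 _]] := uncountable_exists Aunc (countable0 cantor_space).
pose t0 : cantor_subspace F := exist _ x0 (mem_set Ax0).
pose W : set (cantor_subspace F * Y) := [set ty | pt ty.1 <> ty.2].
pose O (x : cantor_space) : set (cantor_subspace F * Y) := [set ty | ty.2 = x].
(* The point [t0] makes every slice nonempty, so distinct [x] give distinct slices. *)
have Oinj : injective O.
  by move=> x y xy; have : O x (t0, x) by []; rewrite xy.
have Wo : open W.
  rewrite openE => -[t y] /= ty.
  have [i tyi] : exists i, pt t i <> y i.
    by apply: contrapT => /forallNP h; apply: ty; apply/funext => i; exact: contrapT (h i).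
  exists ([set t' | cylinder (pt t) i.+1 (pt t')], cylinder y i.+1).
    split; first exact: pt_cylinder_nbhs.
    apply: nbhs_michael; apply: open_nbhs_nbhs; split=> //.
    exact: cylinder_open.
  move=> [t' y'] [/= /(_ i (ltnSn i)) tt' /(_ i (ltnSn i)) yy'] ty'.
  by apply: tyi; rewrite -tt' -yy' ty'.
have Oo x : A x -> open (O x).
  move=> Ax; rewrite openE => -[t y] yx.
  exists (setT, [set y : Y]) => /=; last by move=> [? z] [_ /= ->].
  split; first exact: filterT.
  by apply: michael_isolated; rewrite [y]yx.
move=> /(_ ([set W] `|` O @` A))[|G [GU cG Gcov]].
  split=> [V [->//|[x Ax <-]]|]; first exact: Oo.
  apply/seteqP; split=> // -[t y] _.
  have [e|ne] := pselect (pt t = y); last by exists W => //; left.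
  exists (O y) => //; right; exists y => //; rewrite -e.
  exact: (set_mem (valP t)).
apply: Aunc; apply: sub_countable (countable_inj_preimage Oinj cG).
apply: subset_card_le => x Ax.
pose t : cantor_subspace F := exist _ x (mem_set Ax).
have : (\bigcup_(V in G) V) (t, x) by rewrite Gcov.
by move=> [V GV]; have [->//|[y _ yV]] := GU V GV; rewrite -yV => xy; rewrite /= [x]xy yV.
Qed.

Theorem corollary3p5 (S X : set (set nat)) :
  CH -> semifilter S -> cofinal_scale cF X ->
  productively (menger S) (cantor_subspace (X `|` Nfin)) /\
  ~ productively lindelof (cantor_subspace (X `|` Nfin)).
Proof.
move=> ch Ssf Xscale; split.
  by apply: productively_menger => // c; exact: cF_scale_concentrated.
move=> /(_ (michael [set x : cantor_space | (X `|` Nfin) [set n | x n]])) plind.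
apply: (@michael_diagonal_not_lindelof (X `|` Nfin)).
  move=> cXF; apply: (cF_scale_uncountable Xscale); apply: sub_countable cXF.
  by apply: subset_card_le => x; left.
apply: plind; apply: lindelof_michael => K Kcl KX.
apply: concentrated_closed_countable Kcl KX => c.
exact: cF_scale_concentrated.
Qed.
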